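(* Let $X\subset\mathbb{R}^m$ be Jordan measurable, $G:X\to\mathbb{R}^m$ a Lipschitz function, $Y:=G(X)$, $f:Y\to\mathbb{R}$ bounded and $g:X\to\mathbb{R}$ integrable. Suppose that a) for each Jordan measurable $H\subset X$, the set $G(H)$ is Jordan measurable; b) for each pair of non-overlapping Jordan measurable sets $A,B\subset X$, the sets $G(A)$ and $G(B)$ are non-overlapping; c) $g$ is a density function of the set-function $H\mapsto V(G(H))$ defined on the Jordan measurable subsets $H$ of $X$; d) $f$ or $(f\circ G)\,g$ is integrable. Then both $f$ and $(f\circ G)\,g$ are integrable and $\int_X(f\circ G)\,g=\int_Yf$.
   Context: $V$ denotes Jordan content (volume) of Jordan measurable sets. Two sets are non-overlapping if their interiors are disjoint. ''Integrable'' means Riemann integrable: for a Jordan measurable set $X\subset\mathbb{R}^m$, a function $X\to\mathbb{R}$ is integrable if it is bounded and its lower and upper Darboux integrals (formed with finite partitions of $X$ into pairwise non-overlapping Jordan measurable sets) agree; the integral is the common value. Density function: if $X\subset\mathbb{R}^m$, $\mathscr{D}$ is a set of Jordan measurable subsets of $X$ with $\bigcup\mathscr{D}=X$, and $\Psi:\mathscr{D}\to\mathbb{R}$, then a density function of $\Psi$ is a function $g:X\to\mathbb{R}$ such that for each $H\in\mathscr{D}$ the restriction $g|_H$ is integrable and $\Psi(H)=\int_Hg$. *)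

(* Defs.v *)
(* MathComp-Analysis: R is an arbitrary realType and R^m is 'rV[R]_m, with the
   product topology and the library's (sup) norm. *)
From mathcomp Require Export all_boot all_order all_algebra.
From mathcomp Require Export all_classical all_reals topology normedtype.
Set Implicit Arguments.
Unset Strict Implicit.
Unset Printing Implicit Defensive.
Export Order.TTheory GRing.Theory Num.Theory.
Export numFieldNormedType.Exports.

Local Open Scope classical_set_scope.
Local Open Scope ring_scope.

Section RiemannIntegral.
Context {R : realType} {m : nat}.
Local Notation V := 'rV[R]_m.
Implicit Types (A B E H X : set V) (f g : V -> R).

Definition nonoverlapping A B := A° `&` B° = set0.

Definition box (a b : V) : set V :=
  [set x | forall i, a ord0 i <= x ord0 i <= b ord0 i].

Definition box_volume (a b : V) : R := \prod_(i < m) (b ord0 i - a ord0 i).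

(* Without this condition box_volume would not be the volume of box. *)
Definition box_family n (a b : 'I_n -> V) :=
  forall k i, a k ord0 i <= b k ord0 i.

Definition outer_sums E : set R :=
  [set s | exists n (a b : 'I_n -> V),
    [/\ box_family a b,
        E `<=` \bigcup_(k in [set: 'I_n]) box (a k) (b k) &
        s = \sum_(k < n) box_volume (a k) (b k)]].

Definition inner_sums E : set R :=
  [set s | exists n (a b : 'I_n -> V),
    [/\ box_family a b,
        forall k, box (a k) (b k) `<=` E,
        forall k l, k != l ->
          nonoverlapping (box (a k) (b k)) (box (a l) (b l)) &
        s = \sum_(k < n) box_volume (a k) (b k)]].

(* inf and sup are real-valued, hence meaningful only for bounded E. *)
Definition outer_content E : R := inf (outer_sums E).
Definition inner_content E : R := sup (inner_sums E).

Definition jordan_measurable E :=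
  bounded_set E /\ inner_content E = outer_content E.

(* Jordan content, for Jordan measurable sets. *)
Definition content E : R := outer_content E.

Definition jordan_partition X n (P : 'I_n -> set V) :=
  [/\ forall k, jordan_measurable (P k),
      forall k l, k != l -> nonoverlapping (P k) (P l) &
      \bigcup_(k in [set: 'I_n]) P k = X].

(* An empty piece contributes 0, since its content is 0. *)
Definition lower_sums X f : set R :=
  [set s | exists n (P : 'I_n -> set V),
    jordan_partition X P /\ s = \sum_(k < n) inf (f @` P k) * content (P k)].

Definition upper_sums X f : set R :=
  [set s | exists n (P : 'I_n -> set V),
    jordan_partition X P /\ s = \sum_(k < n) sup (f @` P k) * content (P k)].

Definition lower_integral X f : R := sup (lower_sums X f).
Definition upper_integral X f : R := inf (upper_sums X f).

(* A function on X is represented by a function on the whole space; only its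
   values on X matter. *)
Definition integrable X f :=
  [/\ jordan_measurable X,
      [bounded f x | x in X] &
      lower_integral X f = upper_integral X f].

Definition integral X f : R := lower_integral X f.

Definition density_function X (D : set (set V)) (Psi : set V -> R) g :=
  [/\ forall H, D H -> jordan_measurable H /\ H `<=` X,
      \bigcup_(H in D) H = X &
      forall H, D H -> integrable H g /\ Psi H = integral H g].

End RiemannIntegral.

(* Main.v *)
(** For a partition H_1, ..., H_n of X the images G(H_k) partition Y, and on each
    piece sup f(G(H_k)) V(G(H_k)) = sup (f o G)(H_k) * \int_(H_k) g differs from
    sup ((f o G) g)(H_k) * V(H_k) by at most sup |f| times osc(g, H_k) V(H_k).
    So the Darboux sums of (f o G) g over (H_k) and of f over (G(H_k)) differ by
    at most sup |f| times the gap between the Darboux sums of g. Partitions of Y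
    do not pull back to partitions of X, but since G is Lipschitz a fine
    partition of X is mapped to a fine partition of Y, and the Darboux sums of
    an integrable function over fine partitions are close to its integral. *)
From mathcomp Require Import all_boot all_order all_algebra all_classical.
From mathcomp Require Import all_reals measure lebesgue_measure lebesgue_integral.
From mathcomp Require Import numfun ring lra.
Require Import Defs.
Set Implicit Arguments.
Unset Strict Implicit.
Unset Printing Implicit Defensive.
Local Open Scope classical_set_scope.
Local Open Scope ring_scope.

(** * Volumes of boxes *)

(** Contents are built from finite families of boxes, and even the inequality between inner and
    outer content needs an argument: non-overlapping boxes covered by other boxes have no larger
    total volume. It comes from integrating indicator functions one coordinate at a time. The
    Darboux part has to do without common refinements: sets are cut along boxes only, and closure of
    the Jordan measurable sets under intersection is not established. Erosion takes its place. A
    piece of small diameter that meets the erosion of [P j] lies in [P j], and the erosion keeps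
    almost all of the content of [P j]. So every sufficiently fine partition, refinement or not,
    does nearly as well as [P]. Integrability bounds the sums over all fine partitions, while one
    good partition for each [e] already implies it. This asymmetry lets a single fine partition of
    [X] serve both implications. *)

Section Intervals.
Context {R : realType}.

(** Integrating the pointwise inequality over the line turns each indicator into a length; Lebesgue
    measure enters only here. The flags [u] and [v] allow open and closed ends in one sum, since the
    comparison of volumes below mixes open and closed boxes, and lengths do not see the ends. *)
Lemma sum_itv_ge0 (I : Type) (s : seq I) (c a b : I -> R) (u v : I -> bool) :
  (forall k, a k <= b k) ->
  (forall t, 0 <= \sum_(k <- s)
     c k * (t \in Interval (BSide (u k) (a k)) (BSide (v k) (b k)))%:R) ->
  0 <= \sum_(k <- s) c k * (b k - a k).
Proof.
move=> ab; pose phi k : R -> R :=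
  \1_[set` Interval (BSide (u k) (a k)) (BSide (v k) (b k))].
pose mu := @lebesgue_measure R.
have phiE k : Rintegral mu setT (phi k) = b k - a k.
  rewrite /Rintegral (integral_indic mu measurableT (measurable_itv _)).
  rewrite setIT [X in fine X](_ : _ = (b k - a k)%:E)//.
  rewrite [LHS]lebesgue_measure_itv/= lte_fin.
  by case: ltgtP (ab k) => //= -> _; rewrite subrr.
suff [_ <-] : mu.-integrable setT (EFin \o (fun t => \sum_(k <- s) c k * phi k t))
    /\ Rintegral mu setT (fun t => \sum_(k <- s) c k * phi k t) =
       \sum_(k <- s) c k * (b k - a k).
  move=> h; apply: Rintegral_ge0 => t _.
  rewrite (le_trans (h t))// le_eqVlt; apply/orP; left; apply/eqP.
  apply: eq_bigr => k _; rewrite /phi indicE; congr (_ * (nat_of_bool _)%:R).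
  by rewrite mem_setE.
elim: s => [|k s [ih1 ih2]].
  rewrite big_nil; split.
    have -> : EFin \o (fun t => \sum_(k <- [::]) c k * phi k t) = cst 0%E.
      by apply/funext => t /=; rewrite big_nil.
    exact: integrable0.
  by rewrite /Rintegral integral0_eq// => x _; rewrite big_nil.
have ik : mu.-integrable setT (EFin \o (fun t => c k * phi k t)).
  exact: (integrableZl measurableT (c k) (integrable_indic_itv _ _ _ _)).
have E : (fun t => \sum_(j <- k :: s) c j * phi j t) =
   (fun t => c k * phi k t + \sum_(j <- s) c j * phi j t).
  by apply/funext => t; rewrite big_cons.
rewrite E; split; first exact: (integrableD measurableT ik ih1).
rewrite (RintegralD measurableT ik ih1).
rewrite (RintegralZl _ measurableT (integrable_indic_itv _ _ _ _)).
by rewrite phiE ih2 big_cons.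
Qed.

End Intervals.

Section Boxes.
Context {R : realType} {m : nat}.
Local Notation V := 'rV[R]_m.

Lemma sum_box_ge0 (I : Type) (s : seq I) (c : I -> R) (a b : I -> V)
    (u v : I -> bool) :
  (forall k i, a k ord0 i <= b k ord0 i) ->
  (forall x : V, 0 <= \sum_(k <- s) c k * \prod_(i < m)
     (x ord0 i \in Interval (BSide (u k) (a k ord0 i))
                            (BSide (v k) (b k ord0 i)))%:R) ->
  0 <= \sum_(k <- s) c k * box_volume (a k) (b k).
Proof.
(* [F n] has the first [n] coordinates already integrated out. *)
move=> ab h; pose F (n : nat) (x : V) k (i : 'I_m) : R :=
  if (i < n)%N then b k ord0 i - a k ord0 i else
  (x ord0 i \in Interval (BSide (u k) (a k ord0 i))
                         (BSide (v k) (b k ord0 i)))%:R.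
suff H n : (n <= m)%N -> forall x, 0 <= \sum_(k <- s) c k * \prod_(i < m) F n x k i.
  have /(_ 0) := H m (leqnn _); congr (0 <= _); apply: eq_bigr => k _.
  by congr (_ * _); apply: eq_bigr => i _; rewrite /F ltn_ord.
elim: n => [_ x|n ih nm x]; first exact: h.
pose i0 := Ordinal nm.
pose d k := c k * \prod_(i < m | i != i0) F n.+1 x k i.
have E k : c k * \prod_(i < m) F n.+1 x k i = d k * (b k ord0 i0 - a k ord0 i0).
  by rewrite (bigD1 i0)//= {1}/F ltnS leqnn -mulrA [X in _ * X]mulrC.
rewrite (eq_bigr _ (fun k _ => E k)).
apply: (sum_itv_ge0 (u := u) (v := v)) => // t.
(* Only coordinate [i0] is replaced: the other factors of [F n] at this point are those of [F n.+1]
   at [x]. *)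
have := ih (ltnW nm) (\row_i if i == i0 then t else x ord0 i).
congr (0 <= _); apply: eq_bigr => k _.
rewrite (bigD1 i0)//= {1}/F ltnn mxE eqxx /d -mulrA; congr (_ * _).
rewrite mulrC; congr (_ * _); apply: eq_bigr => i /negbTE ii0.
by rewrite /F mxE ii0 ltnS [(i <= n)%N]leq_eqVlt (_ : (i == n :> nat) = (i == i0))// ii0.
Qed.

Lemma coord_norm_le (x : V) i : `|x ord0 i| <= `|x|.
Proof.
rewrite [leRHS]/Num.norm/= mx_normrE.
exact: (le_bigmax _ (fun ij => `|x ij.1 ij.2|) (ord0, i)).
Qed.

Lemma norm_lt_coord (x : V) (e : R) :
  0 < e -> (forall i, `|x ord0 i| < e) -> `|x| < e.
Proof.
move=> e0 h; rewrite [ltLHS]/Num.norm/= mx_normrE; apply/bigmax_ltP.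
by split=> // -[i j] _; rewrite ord1.
Qed.

Definition open_box (a b : V) : set V :=
  [set x | forall i, a ord0 i < x ord0 i < b ord0 i].

Lemma open_box_interior (a b : V) : open_box a b `<=` (box a b)°.
Proof.
move=> x axb.
have [e e0 he] : exists2 e : R, 0 < e &
    forall i, a ord0 i + e <= x ord0 i /\ x ord0 i + e <= b ord0 i.
  pose F (i : 'I_m) := Order.min (x ord0 i - a ord0 i) (b ord0 i - x ord0 i).
  exists (\big[Order.min/1]_i F i).
    apply/bigmin_gtP => //; split => // i _; have /andP[? ?] := axb i.
    by rewrite lt_min !subr_gt0; apply/andP.
  move=> i; have : \big[Order.min/1]_i F i <= F i by exact: bigmin_le.
  by rewrite le_min lerBrDr lerBrDr ![\big[_/_]_i _ + _]addrC => /andP.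
apply/nbhs_ballP; exists e => //= y; rewrite -ball_normE /= => xy i.
have [h1 h2] := he i.
have : `|(x - y) ord0 i| < e.
  exact: le_lt_trans (coord_norm_le _ _) xy.
rewrite !mxE ltr_distlC => /andP[l1 l2].
rewrite (le_trans _ (ltW l1)) ?lerBrDr//=.
by rewrite (le_trans (ltW l2)).
Qed.

Lemma interior_boxE (a b : V) : (box a b)° = open_box a b.
Proof.
apply/seteqP; split; last exact: open_box_interior.
move=> x /nbhs_ballP[e /= e0 h] i.
have p t : `|t| < e -> a ord0 i <= x ord0 i + t <= b ord0 i.
  (* A move along the diagonal shifts every coordinate by [t], so steps of half the radius both ways
     test all faces at once. *)
  move=> te; have := h (x + t *: const_mx 1) _ i; rewrite !mxE mulr1; apply.
  rewrite -ball_normE /= opprD addNKr normrN.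
  by apply: norm_lt_coord => // j; rewrite !mxE mulr1.
have e2 : `|e / 2| < e by rewrite ger0_norm ?divr_ge0 ?ltW// ltr_pdivrMr// ltr_pMr// ltr1n.
have /andP[_ h1] := p _ e2; have := p (- (e/2)); rewrite normrN => /(_ e2)/andP[h2 _].
have e20 : 0 < e / 2 by rewrite divr_gt0.
rewrite (le_lt_trans h2) ?ltrBlDr ?ltrDl//=.
by rewrite (lt_le_trans _ h1)// ltrDl.
Qed.

Lemma sum_box_volume_le (T U : finType) (a b : T -> V) (c d : U -> V) :
  (forall k i, a k ord0 i <= b k ord0 i) ->
  (forall k i, c k ord0 i <= d k ord0 i) ->
  (forall k l, k != l -> nonoverlapping (box (a k) (b k)) (box (a l) (b l))) ->
  (forall k, box (a k) (b k) `<=` \bigcup_l box (c l) (d l)) ->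
  \sum_k box_volume (a k) (b k) <= \sum_l box_volume (c l) (d l).
Proof.
(* The sum of the indicators of the open boxes is at most that of the closed
   covering boxes. *)
move=> ab cd novl cover.
pose s := index_enum (U + T)%type.
pose C (p : U + T) : R := if p is inl _ then 1 else -1.
pose A p := match p with inl l => c l | inr k => a k end.
pose B p := match p with inl l => d l | inr k => b k end.
pose clos (p : U + T) := if p is inl _ then true else false.
have CE (F : U + T -> R) :
    \sum_(p <- s) C p * F p = \sum_l F (inl l) - \sum_k F (inr k).
  rewrite /s big_sumType /= -sumrN; congr (_ + _); apply: eq_bigr => k _.
    by rewrite mul1r.
  by rewrite mulN1r.
rewrite -subr_ge0.
(* Closed non-overlapping boxes may share faces, where their indicators add up to more than 1; hence
   the open boxes, which have the same volumes. *)
have := @sum_box_ge0 _ s C A B clos (fun p => ~~ clos p).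
rewrite CE; apply; first by case.
move=> x; rewrite CE subr_ge0 /=.
have prodE (P : 'I_m -> bool) : \prod_i (P i)%:R = [forall i, P i]%:R :> R.
  case: (boolP [forall i, P i]) => [/forallP h|/forallPn [i hi]].
    by rewrite big1// => i _; rewrite h.
  by rewrite (bigD1 i)//= (negbTE hi) mul0r.
under eq_bigr do rewrite prodE.
under [leRHS]eq_bigr do rewrite prodE.
have opE k : [forall i, x ord0 i \in `]a k ord0 i, b k ord0 i[] ->
    open_box (a k) (b k) x.
  by move=> /forallP h i; have := h i; rewrite in_itv.
have [k hk|no] := pickP (fun k => [forall i, x ord0 i \in `]a k ord0 i, b k ord0 i[]).
  have [l _ xl] := cover k x (interior_subset (open_box_interior (opE _ hk))).
  rewrite (bigD1 k)//= big1 => [|k' kk'].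
    rewrite addr0 (bigD1 l)//= hk (_ : [forall i, _ ] = true); last first.
      by apply/forallP => i; rewrite in_itv /=; exact: xl.
    by rewrite lerDl sumr_ge0// => j _; rewrite ler0n.
  case: (boolP [forall i, _]) => // /opE hk'.
  have : (@set0 V) x by rewrite -(novl _ _ kk'); split; apply: open_box_interior; [|exact: opE].
  by [].
by rewrite big1 ?sumr_ge0// => k _; rewrite no.
Qed.

End Boxes.

(** * Jordan content *)

Section Content.
Context {R : realType} {m : nat}.
Local Notation V := 'rV[R]_m.
Implicit Types (E X : set V).

Lemma bounded_setP E :
  bounded_set E <-> exists M : R, forall x, E x -> `|x| <= M.
Proof.
split=> [[M [_ h]]|[M h]]; first by exists (M + 1) => x; apply: h; rewrite ltrDl.
exists M; split; first exact: num_real.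
by move=> N MN x /h xM; apply: le_trans xM (ltW MN).
Qed.

Lemma bounded_setS E X : E `<=` X -> bounded_set X -> bounded_set E.
Proof.
by move=> EX /bounded_setP[M h]; apply/bounded_setP; exists M => x /EX/h.
Qed.

Lemma box_bounded (a b : V) : bounded_set (box a b).
Proof.
apply/bounded_setP; exists (`|a| + `|b| + 1) => x xab; apply/ltW.
apply: norm_lt_coord => [|i]; first by rewrite ltr_wpDl ?addr_ge0.
have /andP[l u] := xab i; apply: (@le_lt_trans _ _ (`|a| + `|b|)); last by rewrite ltrDl.
have := coord_norm_le a i; have := coord_norm_le b i.
rewrite !ler_norml => /andP[b1 b2] /andP[a1 a2]; apply/andP; split.
  by rewrite (le_trans _ l)// (le_trans _ a1)// lerN2 lerDl.
by rewrite (le_trans u)// (le_trans b2)// lerDr.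
Qed.

Lemma box_volume_ge0 (a b : V) :
  (forall i, a ord0 i <= b ord0 i) -> 0 <= box_volume a b.
Proof. by move=> ab; apply: prodr_ge0 => i _; rewrite subr_ge0. Qed.

(** Frees the index type from ordinals, so that families of boxes can be glued over dependent
    pairs. *)
Lemma outer_sums_fin (T : finType) (a b : T -> V) E :
  (forall t i, a t ord0 i <= b t ord0 i) ->
  E `<=` \bigcup_t box (a t) (b t) ->
  outer_sums E (\sum_t box_volume (a t) (b t)).
Proof.
move=> ab Eab; exists #|T|, (a \o enum_val), (b \o enum_val); split.
- by move=> k i; exact: ab.
- move=> x /Eab[t _ xt]; exists (enum_rank t) => //=; by rewrite !enum_rankK.
- by rewrite [LHS](reindex (@enum_val T T))//; apply: onW_bij; exact: enum_val_bij.
Qed.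

Lemma inner_sums_fin (T : finType) (a b : T -> V) E :
  (forall t i, a t ord0 i <= b t ord0 i) ->
  (forall t, box (a t) (b t) `<=` E) ->
  (forall t u, t != u -> nonoverlapping (box (a t) (b t)) (box (a u) (b u))) ->
  inner_sums E (\sum_t box_volume (a t) (b t)).
Proof.
move=> ab abE nov; exists #|T|, (a \o enum_val), (b \o enum_val); split.
- by move=> k i; exact: ab.
- by move=> k; exact: abE.
- by move=> k l kl; apply: nov; rewrite (inj_eq enum_val_inj).
- by rewrite [LHS](reindex (@enum_val T T))//; apply: onW_bij; exact: enum_val_bij.
Qed.

Lemma inner_sums_le_outer_sums E s t :
  inner_sums E s -> outer_sums E t -> s <= t.
Proof.
move=> [n [a [b [ab abE nov ->]]]] [p [c [d [cd Ecd ->]]]].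
by apply: sum_box_volume_le => // k x /abE/Ecd.
Qed.

Lemma has_inf_outer_sums E : bounded_set E -> has_inf (outer_sums E).
Proof.
move=> /bounded_setP[M h]; split; last first.
  exists 0 => _ [n [a [b [ab _ ->]]]]; apply: sumr_ge0 => k _.
  exact: box_volume_ge0.
have M1 x : E x -> forall i, - `|M| <= x ord0 i <= `|M|.
  move=> /h xM i; rewrite -ler_norml (le_trans (coord_norm_le _ _))//.
  by rewrite (le_trans xM)// ler_norm.
exists (\sum_(t : unit) box_volume (const_mx (- `|M|) : V) (const_mx `|M|)).
apply: outer_sums_fin.
  by move=> _ i; rewrite !mxE -subr_ge0 opprK addr_ge0.
by move=> x /M1 xM; exists tt => // i; rewrite !mxE.
Qed.

Lemma has_sup_inner_sums E : bounded_set E -> has_sup (inner_sums E).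
Proof.
move=> /has_inf_outer_sums[[s Es] _]; split.
  exists 0, 0%N, (fun=> 0), (fun=> 0); split => //; try by case.
  by rewrite big_ord0.
by exists s => t Et; exact: inner_sums_le_outer_sums Et Es.
Qed.

Lemma inner_content_ge E s : bounded_set E -> inner_sums E s -> s <= inner_content E.
Proof. by move=> /has_sup_inner_sums[_ ub] Es; apply: ub_le_sup. Qed.

Lemma outer_content_le E s : bounded_set E -> outer_sums E s -> outer_content E <= s.
Proof. by move=> /has_inf_outer_sums[_ lb] Es; apply: ge_inf. Qed.

Lemma inner_le_outer E : bounded_set E -> inner_content E <= outer_content E.
Proof.
move=> bE; have [ne _] := has_inf_outer_sums bE; apply: lb_le_inf => // t Et.
have [ne' _] := has_sup_inner_sums bE; apply: ge_sup => // s Es.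
exact: inner_sums_le_outer_sums Es Et.
Qed.

Lemma inner_content_ge0 E : bounded_set E -> 0 <= inner_content E.
Proof.
move=> bE; apply: inner_content_ge => //.
exists 0%N, (fun=> 0), (fun=> 0); split => //; try by case.
by rewrite big_ord0.
Qed.

Lemma jordan_measurable_le E :
  bounded_set E -> outer_content E <= inner_content E -> jordan_measurable E.
Proof. by move=> bE oi; split=> //; apply/eqP; rewrite eq_le oi inner_le_outer. Qed.

Lemma nonoverlappingS (A B C D : set V) :
  A `<=` C -> B `<=` D -> nonoverlapping C D -> nonoverlapping A B.
Proof.
move=> /interiorS AC /interiorS BD nov; rewrite /nonoverlapping -subset0 -nov => x [/AC ? /BD ?].
by split.
Qed.

Lemma split_epsilon (T : finType) (e : R) :
  0 < e -> exists2 d, 0 < d & \sum_(t : T) d <= e.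
Proof.
(* The successor keeps the denominator positive when [T] is empty. *)
move=> e0; exists (e / (#|T|.+1)%:R); first by rewrite divr_gt0.
rewrite sumr_const -[leLHS]mulr_natr -mulrA ger_pMr// mulrC ler_pdivrMr//.
by rewrite mul1r ler_nat.
Qed.

(** Boxes inside non-overlapping sets do not overlap, so nearly optimal inner families of the pieces
    together form an inner family of [E]. The pieces are arbitrary because this is later applied to
    eroded sets, whose measurability is never established. *)
Lemma inner_content_sum (T : finType) (A : T -> set V) E :
  bounded_set E ->
  (forall t, A t `<=` E) ->
  (forall t u, t != u -> nonoverlapping (A t) (A u)) ->
  \sum_t inner_content (A t) <= inner_content E.
Proof.
move=> bE AE nov; apply/ler_addgt0Pr => e e0.
have [d d0 de] := split_epsilon T e0.
have H t : exists s : {n : nat & (('I_n -> V) * ('I_n -> V))%type},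
  let a := (projT2 s).1 in let b := (projT2 s).2 in
  [/\ box_family a b, forall k, box (a k) (b k) `<=` A t,
    forall k l, k != l -> nonoverlapping (box (a k) (b k)) (box (a l) (b l)) &
    inner_content (A t) - d <= \sum_k box_volume (a k) (b k)].
  have bA := bounded_setS (AE t) bE.
  have [_ [n [a [b [ab abA nv ->]]]] h] := sup_adherent d0 (has_sup_inner_sums bA).
  by exists (existT _ n (a, b)); split => //; exact: ltW.
have [f hf] := fin_all_exists H.
pose I := {t : T & 'I_(projT1 (f t))}.
pose a (p : I) := (projT2 (f (tag p))).1 (tagged p).
pose b (p : I) := (projT2 (f (tag p))).2 (tagged p).
have : inner_sums E (\sum_p box_volume (a p) (b p)).
  apply: inner_sums_fin.
  - by move=> [t k] i; have [h _ _ _] := hf t; exact: h.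
  - by move=> [t k]; have [_ h _ _] := hf t; apply: subset_trans (AE t); exact: h.
  - move=> [t k] [u l]; rewrite -tag_eqE /tag_eq /=.
    have [tu|tu _] := eqVneq t u.
      rewrite {}tu in k *; rewrite tagged_asE => kl.
      by have [_ _ h _] := hf u; exact: h.
    have [_ h _ _] := hf t; have [_ h' _ _] := hf u.
    exact: nonoverlappingS (h k) (h' l) (nov _ _ tu).
move=> /(inner_content_ge bE); rewrite -(lerD2r e); apply: le_trans.
rewrite -(sig_big_dep xpredT (fun _ => xpredT) (fun t k =>
  box_volume ((projT2 (f t)).1 k) ((projT2 (f t)).2 k))) /=.
apply: le_trans (lerD (lexx _) de); rewrite -big_split/=.
apply: ler_sum => t _; have [_ _ _ h] := hf t; by rewrite -lerBlDr.
Qed.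

Lemma inner_content_sum_cond (T : finType) (P : pred T) (A : T -> set V) E :
  bounded_set E ->
  (forall t, P t -> A t `<=` E) ->
  (forall t u, P t -> P u -> t != u -> nonoverlapping (A t) (A u)) ->
  \sum_(t | P t) inner_content (A t) <= inner_content E.
Proof.
move=> bE AE nov; pose A' t := if P t then A t else set0.
have A'E t : A' t `<=` E by rewrite /A'; case: ifPn => [/AE|_]; last exact: sub0set.
apply: le_trans (inner_content_sum bE A'E _); last first.
  move=> t u tu; rewrite /A' /nonoverlapping; case: ifPn => Pt; last by rewrite interior0 set0I.
  by case: ifPn => Pu; [exact: nov|rewrite interior0 setI0].
rewrite big_mkcond; apply: ler_sum => t _; rewrite /A'; case: ifPn => // _.
exact/inner_content_ge0/(bounded_setS _ bE).
Qed.

Lemma outer_content_sum (T : finType) (A : T -> set V) E :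
  (forall t, bounded_set (A t)) -> E `<=` \bigcup_t A t ->
  outer_content E <= \sum_t outer_content (A t).
Proof.
move=> bA EA; apply/ler_addgt0Pr => e e0.
have bE : bounded_set E.
  have H t : exists M : R, forall x, A t x -> `|x| <= M by exact/bounded_setP.
  have [M hM] := fin_all_exists H.
  apply/bounded_setP; exists (\big[Order.max/0]_t M t) => x /EA[t _ /hM xM].
  by apply: le_trans xM _; apply: le_bigmax.
have [d d0 de] := split_epsilon T e0.
have H t : exists s : {n : nat & (('I_n -> V) * ('I_n -> V))%type},
  let a := (projT2 s).1 in let b := (projT2 s).2 in
  [/\ box_family a b, A t `<=` \bigcup_k box (a k) (b k) &
    \sum_k box_volume (a k) (b k) <= outer_content (A t) + d].
  have [_ [n [a [b [ab abA ->]]]] h] := inf_adherent d0 (has_inf_outer_sums (bA t)).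
  by exists (existT _ n (a, b)); split => //; exact: ltW.
have [f hf] := fin_all_exists H.
pose I := {t : T & 'I_(projT1 (f t))}.
pose a (p : I) := (projT2 (f (tag p))).1 (tagged p).
pose b (p : I) := (projT2 (f (tag p))).2 (tagged p).
have : outer_sums E (\sum_p box_volume (a p) (b p)).
  apply: outer_sums_fin.
  - by move=> [t k] i; have [h _ _] := hf t; exact: h.
  - move=> x /EA[t _]; have [_ h _] := hf t => /h[k _ xk].
    by exists (existT _ t k).
move=> /(outer_content_le bE) /le_trans; apply.
rewrite -(sig_big_dep xpredT (fun _ => xpredT) (fun t k =>
  box_volume ((projT2 (f t)).1 k) ((projT2 (f t)).2 k))) /=.
apply: le_trans (lerD (lexx _) de); rewrite -big_split/=.
by apply: ler_sum => t _; have [_ _ h] := hf t.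
Qed.

End Content.

(** * Cutting Jordan measurable sets along grids of boxes *)

Section Grid.
Context {R : realType} {m : nat}.
Local Notation V := 'rV[R]_m.
Implicit Types (E X : set V).

Lemma set0_jordan : jordan_measurable (set0 : set V).
Proof.
have b0 : bounded_set (set0 : set V) by apply/bounded_setP; exists 0.
apply: jordan_measurable_le => //; apply: le_trans (inner_content_ge0 b0).
rewrite (le_trans (@outer_content_sum _ _ void (fun=> set0) _ _ _))//.
by rewrite big_pred0// => -[].
Qed.

Lemma inner_content_box (a b : V) : (forall i, a ord0 i <= b ord0 i) ->
  box_volume a b <= inner_content (box a b).
Proof.
move=> ab; apply: inner_content_ge; first exact: box_bounded.
have := @inner_sums_fin R m 'I_1 (fun=> a) (fun=> b) (box a b).
rewrite big_ord1; apply; [by []|by move=> ? ?|].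
by move=> k l; rewrite (ord1 k) (ord1 l) eqxx.
Qed.

Lemma outer_content_box (a b : V) : (forall i, a ord0 i <= b ord0 i) ->
  outer_content (box a b) <= box_volume a b.
Proof.
move=> ab; apply: outer_content_le; first exact: box_bounded.
have := @outer_sums_fin R m 'I_1 (fun=> a) (fun=> b) (box a b).
by rewrite big_ord1; apply=> // x xab; exists ord0.
Qed.

Lemma box_jordan (a b : V) : jordan_measurable (box a b).
Proof.
have [ab|] := boolP [forall i, a ord0 i <= b ord0 i].
  move/forallP: ab => ab; apply: jordan_measurable_le; first exact: box_bounded.
  exact: le_trans (outer_content_box ab) (inner_content_box ab).
move=> /forallPn[i]; rewrite -ltNge => ba.
rewrite (_ : box a b = set0); first exact: set0_jordan.
apply/seteqP; split=> // x /(_ i)/andP[ax xb].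
by have := lt_le_trans ba (le_trans ax xb); rewrite ltxx.
Qed.

Lemma box_setI_jordan (a b c d : V) : jordan_measurable (box a b `&` box c d).
Proof.
rewrite (_ : _ `&` _ = box (\row_i Order.max (a ord0 i) (c ord0 i))
                           (\row_i Order.min (b ord0 i) (d ord0 i))).
  exact: box_jordan.
apply/seteqP; split=> [x [h1 h2] i|x h].
  by rewrite !mxE ge_max le_min; case/andP: (h1 i) => -> ->; case/andP: (h2 i) => -> ->.
split=> i; have := h i; rewrite !mxE ge_max le_min;
  by move=> /andP[/andP[? ?] /andP[? ?]]; apply/andP.
Qed.

Section Cut.
Variables (T : finType) (p q : T -> V).
Let Q t := box (p t) (q t).
Hypothesis Q_nov : forall t u, t != u -> nonoverlapping (Q t) (Q u).

(** This reverse of superadditivity fails for general pieces. It holds for cells because a box meets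
    a cell in a box, whose two contents agree: each box of an inner family is split by subadditivity
    of outer content, and its parts are then reread as inner content. *)
Lemma inner_content_cut X : bounded_set X -> X `<=` \bigcup_t Q t ->
  inner_content X <= \sum_t inner_content (X `&` Q t).
Proof.
move=> bX XQ; have [ne _] := has_sup_inner_sums bX; apply: ge_sup => //.
move=> _ [n [a [b [ab abX nov ->]]]].
apply: (@le_trans _ _ (\sum_t \sum_k inner_content (box (a k) (b k) `&` Q t))).
  rewrite exchange_big; apply: ler_sum => k _.
  apply: le_trans (inner_content_box (ab k)) _.
  apply: le_trans (inner_le_outer (box_bounded _ _)) _.
  under eq_bigr do rewrite (box_setI_jordan _ _ _ _).2.
  apply: outer_content_sum => [t|x xk]; first exact: (box_setI_jordan _ _ _ _).1.
  by have [t _ xt] := XQ _ (abX _ _ xk); exists t.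
apply: ler_sum => t _; apply: inner_content_sum.
- exact: bounded_setS (@subIsetl _ _ _) bX.
- by move=> k; apply: setSI; exact: abX.
- by move=> k l /nov; apply: nonoverlappingS; exact: subIsetl.
Qed.

Lemma outer_content_cut X : bounded_set X ->
  \sum_t outer_content (X `&` Q t) <= outer_content X.
Proof.
move=> bX; have [ne _] := has_inf_outer_sums bX; apply: lb_le_inf => //.
move=> _ [n [a [b [ab Xab ->]]]].
apply: (@le_trans _ _ (\sum_t \sum_k outer_content (box (a k) (b k) `&` Q t))).
  apply: ler_sum => t _; apply: outer_content_sum.
    by move=> k; exact: (box_setI_jordan _ _ _ _).1.
  by move=> x [/Xab[k _ xk] xt]; exists k.
rewrite exchange_big; apply: ler_sum => k _.
apply: le_trans (outer_content_box (ab k)).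
apply: le_trans (inner_le_outer (box_bounded _ _)).
under eq_bigr do rewrite -(box_setI_jordan _ _ _ _).2.
apply: inner_content_sum; first exact: box_bounded.
  by move=> t; exact: subIsetl.
by move=> t u /Q_nov; apply: nonoverlappingS; exact: subIsetr.
Qed.

(* The defects outer - inner of the pieces are nonnegative and add up to at most
   that of [X], so no intersection of general Jordan measurable sets is needed. *)
Lemma cut_jordan X t : jordan_measurable X -> X `<=` \bigcup_t Q t ->
  jordan_measurable (X `&` Q t).
Proof.
move=> [bX jX] XQ.
have bXQ u : bounded_set (X `&` Q u) by exact: bounded_setS (@subIsetl _ _ _) bX.
apply: jordan_measurable_le => //; rewrite -subr_le0.
have : \sum_u (outer_content (X `&` Q u) - inner_content (X `&` Q u)) <= 0.
  rewrite sumrB subr_le0 (le_trans (outer_content_cut bX))// -jX.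
  exact: inner_content_cut.
apply: le_trans; rewrite (bigD1 t)//= lerDl sumr_ge0// => u _.
by rewrite subr_ge0 inner_le_outer.
Qed.

End Cut.

Lemma fine_grid E (d : R) : bounded_set E -> 0 < d ->
  exists (T : finType) (p q : T -> V),
  [/\ forall t u, t != u -> nonoverlapping (box (p t) (q t)) (box (p u) (q u)),
      E `<=` \bigcup_t box (p t) (q t) &
      forall t x y, box (p t) (q t) x -> box (p t) (q t) y -> `|x - y| < d].
Proof.
move=> /bounded_setP[M0 hM] d0.
(* Side [d / 2] gives closed cells of diameter at most [d / 2] in the sup norm, hence strictly below
   [d]. *)
pose M := `|M0|; pose e := d / 2; have e0 : 0 < e by rewrite divr_gt0.
have M_ge0 : 0 <= M by exact: normr_ge0.
have EM x i : E x -> - M <= x ord0 i <= M.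
  move=> /hM xM; rewrite -ler_norml (le_trans (coord_norm_le _ _))//.
  by rewrite (le_trans xM)// ler_norm.
(* Cells 0 to [N] cover each axis from [- M] to [M]: the endpoint [M] falls into cell [N], whence
   the index type of size [N.+1]. *)
pose N := Num.truncn (2 * M / e).
exists {ffun 'I_m -> 'I_N.+1}.
exists (fun t : {ffun 'I_m -> 'I_N.+1} => \row_i (- M + e * (t i)%:R)).
exists (fun t : {ffun 'I_m -> 'I_N.+1} => \row_i (- M + e * (t i).+1%:R)); split.
- move=> t u tu; rewrite /nonoverlapping !interior_boxE -subset0 => x [xt xu].
  have [i] : exists i, t i != u i.
    apply/existsP; apply: contra_neqT tu => /existsPn h; apply/ffunP => i.
    by apply/eqP; rewrite -[_ == _]negbK; exact: h.
  have := xt i; have := xu i; rewrite !mxE => /andP[u1 u2] /andP[t1 t2].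
  have lt_of j k : - M + e * j%:R < - M + e * k.+1%:R -> (j <= k)%N.
    by rewrite ltrD2l ltr_pM2l// ltr_nat.
  have l1 := lt_of _ _ (lt_trans u1 t2); have l2 := lt_of _ _ (lt_trans t1 u2).
  by move/eqP; case; apply/val_inj/eqP; rewrite eqn_leq l1 l2.
- move=> x Ex; exists [ffun i => inord (Num.truncn ((x ord0 i + M) / e))] => //= i.
  have /andP[l u] := EM x i Ex; rewrite !mxE ffunE.
  have xM0 : 0 <= (x ord0 i + M) / e by rewrite divr_ge0 ?(ltW e0)//; lra.
  rewrite inordK; last first.
    rewrite ltnS; apply: le_truncn; rewrite ler_pM2r ?invr_gt0//; lra.
  have /andP[h1 h2] := truncn_itv xM0.
  rewrite ler_pdivlMr// in h1; rewrite ltr_pdivrMr// in h2.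
  by apply/andP; split; lra.
- move=> t x y xt yt; apply: norm_lt_coord => // i.
  have := xt i; have := yt i; rewrite !mxE => /andP[y1 y2] /andP[x1 x2].
  have ed : e < d by rewrite /e; lra.
  rewrite -natr1 mulrDr mulr1 in x2 y2.
  by rewrite ltr_norml; apply/andP; split; lra.
Qed.

(** Superadditivity of inner content and subadditivity of outer content squeeze the sum. *)
Lemma partition_content X n (P : 'I_n -> set V) :
  jordan_measurable X -> jordan_partition X P ->
  \sum_k content (P k) = content X.
Proof.
move=> [bX jX] [jP nP XP]; apply/eqP; rewrite eq_le; apply/andP; split.
  rewrite /content -jX; under eq_bigr do rewrite -(jP _).2.
  apply: inner_content_sum => // k; rewrite -XP; exact: bigcup_sup.
by apply: outer_content_sum; [move=> k; exact: (jP k).1|rewrite XP].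
Qed.

Lemma fine_partition X (d : R) : jordan_measurable X -> 0 < d ->
  exists n (P : 'I_n -> set V), jordan_partition X P /\
    forall k x y, P k x -> P k y -> `|x - y| < d.
Proof.
move=> jX d0; have [T [p [q [nov XQ diam]]]] := fine_grid jX.1 d0.
exists #|T|, (fun k => X `&` box (p (enum_val k)) (q (enum_val k))); split; last first.
  by move=> k x y [_ ?] [_ ?]; exact: diam.
split.
- by move=> k; apply: cut_jordan.
- move=> k l kl; apply: nonoverlappingS (nov (enum_val k) (enum_val l) _); try exact: subIsetr.
  by rewrite (inj_eq enum_val_inj).
- apply/seteqP; split=> [x [k _ []//]|x Xx]; have [t _ xt] := XQ x Xx.
  by exists (enum_rank t) => //; rewrite enum_rankK.
Qed.

End Grid.

(** * Inner approximation by eroded sets *)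

Section Erosion.
Context {R : realType} {m : nat}.
Local Notation V := 'rV[R]_m.

Lemma bernoulli_ineq (t : R) n : 0 <= t <= 1 -> 1 - n%:R * t <= (1 - t) ^+ n.
Proof.
move=> /andP[t0 t1]; elim: n => [|n ih]; first by rewrite mul0r subr0 expr0.
rewrite exprS; apply: (@le_trans _ _ ((1 - t) * (1 - n%:R * t))); last first.
  by rewrite ler_wpM2l// subr_ge0.
have : 0 <= n%:R * t * t by rewrite !mulr_ge0.
by rewrite -natr1; lra.
Qed.

(** Its purpose: a set whose points are pairwise at distance below [d] and which meets the erosion
    lies in [E]. *)
Definition erosion (E : set V) (d : R) : set V :=
  [set x | forall y, `|x - y| < d -> E y].

Lemma erosion_sub E d : 0 < d -> erosion E d `<=` E.
Proof. by move=> d0 x; apply; rewrite subrr normr0. Qed.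

(** The boxes of a nearly optimal inner family are shrunk about their centres by the factor [1 - t].
    Proportional shrinking never inverts a box, multiplies all volumes by the same [(1 - t) ^+ m],
    and leaves a positive margin along every side of positive width. *)
Lemma inner_content_erosion E (e : R) : bounded_set E -> 0 < e ->
  exists2 d, 0 < d & inner_content E - e <= inner_content (erosion E d).
Proof.
move=> bE e0; have e20 : 0 < e / 2 by rewrite divr_gt0.
have [_ [n [a [b [ab abE nov ->]]]] sE] := sup_adherent e20 (has_sup_inner_sums bE).
set s := \sum_(k < n) _ in sE.
have s0 : 0 <= s by apply: sumr_ge0 => k _; exact: box_volume_ge0.
have D0 : 0 < m%:R * s + e / 2 by rewrite ltr_wpDl// mulr_ge0.
(* Chosen so that [t <= 1] and [m%:R * t * s <= e / 2], the loss allowed by Bernoulli's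
   inequality. *)
pose t := e / 2 / (m%:R * s + e / 2).
have t0 : 0 < t by rewrite divr_gt0.
have t1 : t <= 1 by rewrite ler_pdivrMr// mul1r lerDr mulr_ge0.
have ts : s - e / 2 <= (1 - t) ^+ m * s.
  have t01 : 0 <= t <= 1 by rewrite t1 ltW.
  apply: le_trans (ler_wpM2r s0 (bernoulli_ineq m t01)).
  have : t * (m%:R * s + e / 2) = e / 2 by rewrite /t divfK// gt_eqF.
  have : 0 <= t * (e / 2) by rewrite mulr_ge0 ?ltW.
  by lra.
pose w k i := b k ord0 i - a k ord0 i.
pose a' k : V := \row_i (a k ord0 i + w k i * t / 2).
pose b' k : V := \row_i (b k ord0 i - w k i * t / 2).
have w0 k i : 0 <= w k i by rewrite subr_ge0.
have ab' k i : a' k ord0 i <= b' k ord0 i.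
  by rewrite !mxE; have := ler_wpM2l (w0 k i) t1; rewrite /w; lra.
have vol' k : box_volume (a' k) (b' k) = (1 - t) ^+ m * box_volume (a k) (b k).
  have -> : (1 - t) ^+ m = \prod_(i < m) (1 - t) by rewrite prodr_const card_ord.
  rewrite /box_volume -big_split/=.
  by apply: eq_bigr => i _; rewrite !mxE /w; field.
(* The smallest margin left by the shrinking. Sides of width 0 are skipped to keep [d] positive;
   boxes having such a side have volume 0 and are discarded through [P]. *)
pose d := \big[Order.min/1]_(ki : 'I_n * 'I_m)
  if 0 < w ki.1 ki.2 then w ki.1 ki.2 * t / 2 else 1.
have d0 : 0 < d.
  apply/bigmin_gtP; split => // -[k i] _ /=; case: ifPn => // wki.
  by rewrite divr_gt0// mulr_gt0.
exists d => //.
pose P k := [forall i, 0 < w k i].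
have sP : s = \sum_(k | P k) box_volume (a k) (b k).
  rewrite [RHS]big_mkcond; apply: eq_bigr => k _; case: ifPn => // /forallPn[i].
  rewrite lt_neqAle w0 andbT negbK => /eqP wki.
  by rewrite /box_volume (bigD1 i)//= -/(w k i) -wki mul0r.
have box' k : box (a' k) (b' k) `<=` box (a k) (b k).
  move=> x h i; have := h i; rewrite !mxE => /andP[h1 h2].
  have : 0 <= w k i * t by rewrite mulr_ge0 ?w0 ?ltW.
  by move=> wt; apply/andP; split; lra.
apply: (@le_trans _ _ (s - e / 2)); first by rewrite /inner_content; lra.
apply: le_trans ts _; rewrite sP mulr_sumr.
apply: (@le_trans _ _ (\sum_(k | P k) inner_content (box (a' k) (b' k)))).
  by apply: ler_sum => k _; rewrite -vol'; exact: inner_content_box.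
apply: inner_content_sum_cond.
- exact: bounded_setS (erosion_sub d0) bE.
- move=> k /forallP Pk x xk y xy; apply: (abE k) => i.
  have := xk i; rewrite !mxE => /andP[h1 h2].
  have : d <= w k i * t / 2.
    by apply: le_trans (bigmin_le _ (k, i) _) _; rewrite /= Pk.
  have := le_lt_trans (coord_norm_le _ i) xy; rewrite !mxE ltr_norml => /andP[h3 h4] h5.
  by apply/andP; split; lra.
- by move=> k l _ _ /nov; apply: nonoverlappingS.
Qed.

End Erosion.

(** * Darboux sums *)

Section Darboux.
Context {R : realType} {m : nat}.
Local Notation V := 'rV[R]_m.
Implicit Types (X : set V) (f g : V -> R).

Definition upper_sum f n (P : 'I_n -> set V) : R :=
  \sum_(k < n) sup (f @` P k) * content (P k).

Definition lower_sum f n (P : 'I_n -> set V) : R :=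
  \sum_(k < n) inf (f @` P k) * content (P k).

Lemma lower_sumN f n (P : 'I_n -> set V) :
  lower_sum f P = - upper_sum (fun x => - f x) P.
Proof.
rewrite /lower_sum /upper_sum -sumrN; apply: eq_bigr => k _.
by rewrite -mulNr /inf image_comp.
Qed.

Lemma content_ge0 (A : set V) : bounded_set A -> 0 <= content A.
Proof. by move=> bA; apply: le_trans (inner_content_ge0 bA) (inner_le_outer bA). Qed.

Lemma content_set0 : content (set0 : set V) = 0.
Proof.
have [b0 _] := @set0_jordan R m; apply/eqP; rewrite eq_le content_ge0// andbT.
have := @outer_content_sum R m 'I_0 (fun=> set0) set0.
by rewrite big_ord0; apply.
Qed.

(** For empty [A] the supremum is 0 by convention, whence [0 <= M]. *)
Lemma sup_image_norm_le f (A : set V) M : 0 <= M ->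
  (forall x, A x -> `|f x| <= M) -> `|sup (f @` A)| <= M.
Proof.
move=> M0 fM; have [->|/set0P[x Ax]] := eqVneq A set0.
  by rewrite image_set0 sup0 normr0.
have ub : ubound (f @` A) M by move=> _ [y /fM + <-]; rewrite ler_norml => /andP[].
have := fM x Ax; rewrite !ler_norml => /andP[l _]; apply/andP; split.
  by apply: le_trans l _; apply: ub_le_sup; [exists M|exists x].
by apply: ge_sup => //; exists (f x), x.
Qed.

Lemma sup_image_le f (A B : set V) M : A !=set0 -> A `<=` B ->
  (forall x, B x -> `|f x| <= M) -> sup (f @` A) <= sup (f @` B).
Proof.
move=> [x Ax] AB fM; apply: ge_sup; first by exists (f x), x.
move=> _ [y /AB By <-]; apply: ub_le_sup; last by exists y.
by exists M => _ [z /fM + <-]; rewrite ler_norml => /andP[].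
Qed.

Definition fine_below n (H : 'I_n -> set V) (d : R) :=
  forall k x y, H k x -> H k y -> `|x - y| < d.

(** Darboux's theorem. Since [H] need not refine [P], its pieces are sorted: those inside some [P j]
    have suprema no larger than that of [P j], and the bad ones have small total content because
    they avoid the eroded [P j]. *)
Lemma upper_sum_refine X f M n (P : 'I_n -> set V) e :
  jordan_measurable X -> jordan_partition X P -> 0 <= M ->
  (forall x, X x -> `|f x| <= M) -> 0 < e ->
  exists2 d, 0 < d & forall p (H : 'I_p -> set V),
    jordan_partition X H -> fine_below H d ->
    upper_sum f H <= upper_sum f P + e.
Proof.
move=> jX PX M0 fM e0; have [jP nP XP] := PX.
have PsubX j : P j `<=` X by rewrite -XP; exact: bigcup_sup.
(* Bad pieces cost [M * B] twice: for their own terms in the sum over [H], and for the part of the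
   content of the [P j] that the good pieces leave unfilled. The added 1 keeps the denominator
   positive. *)
pose e1 := e / (2 * M + 1).
have M1 : 0 < 2 * M + 1 by lra.
have e10 : 0 < e1 by rewrite divr_gt0.
have [e2 e20 e21] := split_epsilon 'I_n e10.
have erode j : exists d, 0 < d /\
    inner_content (P j) - e2 <= inner_content (erosion (P j) d).
  by have [d ? ?] := inner_content_erosion (jP j).1 e20; exists d.
have [D hD] := fin_all_exists erode.
pose d := \big[Order.min/1]_j D j.
exists d; first by apply/bigmin_gtP; split => // j _; case: (hD j).
move=> p H HX Hd; have [jH nH XH] := HX.
have HsubX j : H j `<=` X by rewrite -XH; exact: bigcup_sup.
(* A piece with empty interior may lie in several [P j]; the choice charges it to only one. *)
pose jj k := [pick j | `[< H k `<=` P j >]].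
pose bad k := jj k == None.
pose v k := content (H k).
have v0 k : 0 <= v k by apply: content_ge0; exact: (jH k).1.
pose B := \sum_(k | bad k) v k.
have B0 : 0 <= B by apply: sumr_ge0.
(* A piece of [H] meeting an eroded [P j] lies in [P j], so the others are
   disjoint from all the eroded pieces. *)
have Be : B <= e1.
  pose F (s : 'I_n + 'I_p) := match s with inl j => erosion (P j) (D j) | inr k => H k end.
  pose Q (s : 'I_n + 'I_p) := if s is inr k then bad k else true.
  have disj j k : bad k -> nonoverlapping (erosion (P j) (D j)) (H k).
    rewrite /bad /jj; case: pickP => // no _.
    rewrite /nonoverlapping -subset0 => x [/interior_subset xe /interior_subset xH].
    suff : `[< H k `<=` P j >] by rewrite no.
    apply/asboolP => y Hy; apply: xe.
    by apply: lt_le_trans (Hd _ _ _ xH Hy) _; exact: bigmin_le.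
  have : \sum_(s | Q s) inner_content (F s) <= inner_content X.
    apply: inner_content_sum_cond; first exact: jX.1.
      move=> [j|k] _ /=; last exact: HsubX.
      by apply: subset_trans (PsubX j); apply: erosion_sub; case: (hD j).
    move=> [j|k] [j'|k'] //= b b' ss.
    - exact: nonoverlappingS (erosion_sub (hD j).1) (erosion_sub (hD j').1) (nP j j' ss).
    - exact: disj.
    - by rewrite /nonoverlapping setIC; exact: disj.
    - exact: nH.
  rewrite big_sumType /= jX.2 -[outer_content X]/(content X) -(partition_content jX PX).
  have -> : \sum_(k | bad k) inner_content (H k) = B.
    by apply: eq_bigr => k _; rewrite (jH k).2.
  have : \sum_j inner_content (P j) - \sum_(j < n) e2 <=
      \sum_j inner_content (erosion (P j) (D j)).
    by rewrite -sumrB; apply: ler_sum => j _; case: (hD j).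
  have -> : \sum_j inner_content (P j) = \sum_j content (P j).
    by apply: eq_bigr => k _; rewrite (jP k).2.
  by lra.
pose S j := sup (f @` P j).
have SM j : `|S j| <= M by apply: sup_image_norm_le => // x /PsubX /fM.
pose W j := \sum_(k | jj k == Some j) v k.
have WP j : W j <= content (P j).
  rewrite /content -(jP j).2 /W.
  under eq_bigr do rewrite /v /content -(jH _).2.
  apply: inner_content_sum_cond; first exact: (jP j).1.
    by move=> k; rewrite /jj; case: pickP => // j' /asboolP h /eqP[<-].
  by move=> k k' _ _; exact: nH.
have WB : \sum_j W j + B = \sum_j content (P j).
  rewrite (partition_content jX PX) -(partition_content jX HX).
  rewrite /W /B (exchange_big_dep xpredT)//= [X in _ + X]big_mkcond -big_split/=.
  apply: eq_bigr => k _; rewrite /bad; case: (jj k) => [j|].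
    rewrite (bigD1 j)//= big1 ?addr0// => j' /andP[/eqP[->]]; by rewrite eqxx.
  by rewrite big_pred0// add0r.
have step1 : upper_sum f H <= \sum_j S j * W j + M * B.
  rewrite /W /B mulr_sumr; under [X in X + _]eq_bigr do rewrite mulr_sumr.
  rewrite (exchange_big_dep xpredT)//= [X in _ + X]big_mkcond -big_split/=.
  apply: ler_sum => k _; rewrite /bad /jj; case: pickP => [j /asboolP HP|_] /=.
    rewrite (bigD1 j)//= big1 ?addr0; last by move=> j' /andP[/eqP[->]]; rewrite eqxx.
    have [H0|/set0P Hn] := eqVneq (H k) set0.
      by rewrite /v H0 content_set0 !mulr0.
    apply: ler_wpM2r; first exact: v0.
    by rewrite /S; apply: (sup_image_le Hn HP (M := M)) => x /PsubX; exact: fM.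
  rewrite big_pred0// add0r; apply: ler_wpM2r; first exact: v0.
  apply: le_trans (ler_norm _) _; apply: sup_image_norm_le => // x /HsubX; exact: fM.
(* Lowering the weight of [S j] from [content (P j)] to [W j] can raise the sum when [S j] is
   negative, but by at most [M] per unit of content, and by [WB] the total deficit is [B]. *)
have step2 : \sum_j S j * W j <= upper_sum f P + M * B.
  have -> : M * B = \sum_j M * (content (P j) - W j).
    by rewrite -mulr_sumr sumrB -WB; congr (_ * _); lra.
  rewrite /upper_sum -big_split/=; apply: ler_sum => j _; rewrite -/(S j).
  have := SM j; rewrite ler_norml => /andP[Sl Su].
  have : 0 <= (M + S j) * (content (P j) - W j).
    by apply: mulr_ge0; [lra|rewrite subr_ge0].
  by lra.
have : (2 * M + 1) * B <= e.
  by rewrite mulrC -ler_pdivlMr.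
by lra.
Qed.

End Darboux.

(** * Integrability through fine partitions *)

Section Integral.
Context {R : realType} {m : nat}.
Local Notation V := 'rV[R]_m.
Implicit Types (X : set V) (f g : V -> R).

Lemma fine_belowS n (H : 'I_n -> set V) d d' :
  d <= d' -> fine_below H d -> fine_below H d'.
Proof. by move=> dd h k x y Hx Hy; exact: lt_le_trans (h k x y Hx Hy) dd. Qed.

Lemma bounded_funP X f : [bounded f x | x in X] <->
  exists2 M : R, 0 <= M & forall x, X x -> `|f x| <= M.
Proof.
split=> [[M [_ h]]|[M M0 h]].
  exists (`|M| + 1); first by rewrite addr_ge0.
  by move=> x; apply: h; rewrite ltr_pwDr// ler_norm.
exists M; split; first exact: num_real.
by move=> N MN x /h xM; apply: le_trans xM (ltW MN).
Qed.

Lemma lower_sum_refine X f M n (P : 'I_n -> set V) e :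
  jordan_measurable X -> jordan_partition X P -> 0 <= M ->
  (forall x, X x -> `|f x| <= M) -> 0 < e ->
  exists2 d, 0 < d & forall p (H : 'I_p -> set V),
    jordan_partition X H -> fine_below H d ->
    lower_sum f P - e <= lower_sum f H.
Proof.
move=> jX PX M0 fM e0.
have NfM x : X x -> `|- f x| <= M by rewrite normrN; exact: fM.
have [d d0 h] := upper_sum_refine jX PX M0 NfM e0.
exists d => // p H HX Hd; rewrite !lower_sumN.
by have := h p H HX Hd; lra.
Qed.

Lemma lower_sum_le_upper_sum f M X n (P : 'I_n -> set V) :
  jordan_partition X P -> (forall x, X x -> `|f x| <= M) ->
  lower_sum f P <= upper_sum f P.
Proof.
move=> [jP _ XP] fM; apply: ler_sum => k _.
have [->|/set0P[x Px]] := eqVneq (P k) set0; first by rewrite content_set0 !mulr0.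
apply: ler_wpM2r; first exact: content_ge0 (jP k).1.
have fMk y : P k y -> - M <= f y <= M.
  by move=> Py; rewrite -ler_norml; apply: fM; rewrite -XP; exists k.
apply: (@le_trans _ _ (f x)).
  by apply: ge_inf; [exists (- M) => _ [y /fMk/andP[? _] <-]|exists x].
by apply: ub_le_sup; [exists M => _ [y /fMk/andP[_ ?] <-]|exists x].
Qed.

Lemma upper_sum_norm_le f M X n (P : 'I_n -> set V) :
  jordan_measurable X -> jordan_partition X P -> 0 <= M ->
  (forall x, X x -> `|f x| <= M) -> `|upper_sum f P| <= M * content X.
Proof.
move=> jX PX M0 fM; have [jP _ XP] := PX.
rewrite -(partition_content jX PX) mulr_sumr.
apply: le_trans (ler_norm_sum _ _ _) _; apply: ler_sum => k _.
rewrite normrM (ger0_norm (content_ge0 (jP k).1)).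
apply: ler_wpM2r; first exact: content_ge0 (jP k).1.
by apply: sup_image_norm_le => // x Px; apply: fM; rewrite -XP; exists k.
Qed.

Lemma trivial_partition X : jordan_measurable X ->
  jordan_partition X (fun _ : 'I_1 => X).
Proof.
move=> jX; split=> // [k l|]; first by rewrite !ord1 eqxx.
by apply/seteqP; split=> [x [_ _ //]|x Xx]; exists ord0.
Qed.

Lemma has_inf_upper_sums X f M : jordan_measurable X -> 0 <= M ->
  (forall x, X x -> `|f x| <= M) -> has_inf (upper_sums X f).
Proof.
move=> jX M0 fM; split.
  by eexists; exists 1%N, (fun=> X); split; [exact: trivial_partition|reflexivity].
exists (- (M * content X)) => _ [n [P [PX ->]]].
by have := upper_sum_norm_le jX PX M0 fM; rewrite ler_norml => /andP[].
Qed.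

Lemma has_sup_lower_sums X f M : jordan_measurable X -> 0 <= M ->
  (forall x, X x -> `|f x| <= M) -> has_sup (lower_sums X f).
Proof.
move=> jX M0 fM; split.
  by eexists; exists 1%N, (fun=> X); split; [exact: trivial_partition|reflexivity].
exists (M * content X) => _ [n [P [PX ->]]].
apply: le_trans (lower_sum_le_upper_sum PX fM) _.
by have := upper_sum_norm_le jX PX M0 fM; rewrite ler_norml => /andP[].
Qed.

Lemma upper_integral_le X f M n (P : 'I_n -> set V) : jordan_measurable X ->
  0 <= M -> (forall x, X x -> `|f x| <= M) -> jordan_partition X P ->
  upper_integral X f <= upper_sum f P.
Proof.
move=> jX M0 fM PX; apply: ge_inf; first exact: (has_inf_upper_sums jX M0 fM).2.
by exists n, P.
Qed.

Lemma lower_integral_ge X f M n (P : 'I_n -> set V) : jordan_measurable X ->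
  0 <= M -> (forall x, X x -> `|f x| <= M) -> jordan_partition X P ->
  lower_sum f P <= lower_integral X f.
Proof.
move=> jX M0 fM PX; apply: ub_le_sup; first exact: (has_sup_lower_sums jX M0 fM).2.
by exists n, P.
Qed.

(** A fine partition [H] stands in for the common refinement of [P] and [Q]: up to [e / 2] each, its
    lower sum is at least that of [P] and its upper sum at most that of [Q]. *)
Lemma lower_integral_le_upper_integral X f : jordan_measurable X ->
  [bounded f x | x in X] -> lower_integral X f <= upper_integral X f.
Proof.
move=> jX /bounded_funP[M M0 fM].
apply: ge_sup; first exact: (has_sup_lower_sums jX M0 fM).1.
move=> _ [n [P [PX ->]]].
apply: lb_le_inf; first exact: (has_inf_upper_sums jX M0 fM).1.
move=> _ [p [Q [QX ->]]]; apply/ler_addgt0Pr => e e0.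
have e20 : 0 < e / 2 by rewrite divr_gt0.
have [d d0 hd] := lower_sum_refine jX PX M0 fM e20.
have [d' d0' hd'] := upper_sum_refine jX QX M0 fM e20.
have dd : 0 < Order.min d d' by rewrite lt_min d0.
have [k [H [HX Hd]]] := fine_partition jX dd.
have := hd k H HX (fine_belowS _ Hd); rewrite ge_min lexx => /(_ isT).
have := hd' k H HX (fine_belowS _ Hd); rewrite ge_min lexx orbT => /(_ isT).
by have := lower_sum_le_upper_sum HX fM; rewrite /lower_sum /upper_sum; lra.
Qed.

Lemma integrable_fine_sums X f e : integrable X f -> 0 < e ->
  exists2 d, 0 < d & forall p (H : 'I_p -> set V),
    jordan_partition X H -> fine_below H d ->
    integral X f - e <= lower_sum f H /\ upper_sum f H <= integral X f + e.
Proof.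
move=> [jX /bounded_funP[M M0 fM] lu] e0.
have e20 : 0 < e / 2 by rewrite divr_gt0.
have [_ [n [P [PX ->]]] hP] := sup_adherent e20 (has_sup_lower_sums jX M0 fM).
have [_ [n' [Q [QX ->]]] hQ] := inf_adherent e20 (has_inf_upper_sums jX M0 fM).
have [d d0 hd] := lower_sum_refine jX PX M0 fM e20.
have [d' d0' hd'] := upper_sum_refine jX QX M0 fM e20.
exists (Order.min d d'); first by rewrite lt_min d0.
move=> p H HX Hd.
have Hd1 : fine_below H d by apply: fine_belowS Hd; rewrite ge_min lexx.
have Hd2 : fine_below H d' by apply: fine_belowS Hd; rewrite ge_min lexx orbT.
have := hd p H HX Hd1; have := hd' p H HX Hd2.
rewrite -/(lower_integral X f) -/(lower_sum f P) in hP.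
rewrite -/(upper_integral X f) -/(upper_sum f Q) -lu in hQ.
by rewrite /integral; split; lra.
Qed.

Lemma integrable_of_sums X f c : jordan_measurable X -> [bounded f x | x in X] ->
  (forall e, 0 < e -> exists n (P : 'I_n -> set V),
    [/\ jordan_partition X P, c - e <= lower_sum f P & upper_sum f P <= c + e]) ->
  integrable X f /\ integral X f = c.
Proof.
move=> jX bf h; have [M M0 fM] := (bounded_funP X f).1 bf.
have lu := lower_integral_le_upper_integral jX bf.
have uc : upper_integral X f <= c.
  apply/ler_addgt0Pr => e /h[n [P [PX _ hu]]].
  exact: le_trans (upper_integral_le jX M0 fM PX) hu.
have cl : c <= lower_integral X f.
  apply/ler_addgt0Pr => e /h[n [P [PX hl _]]]; rewrite -lerBlDr.
  exact: le_trans hl (lower_integral_ge jX M0 fM PX).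
split; first by split=> //; apply/eqP; rewrite eq_le lu (le_trans uc).
by apply/eqP; rewrite eq_le (le_trans lu).
Qed.

Lemma integral_bounds X g : integrable X g ->
  inf (g @` X) * content X <= integral X g <= sup (g @` X) * content X.
Proof.
move=> [jX /bounded_funP[M M0 gM] lu]; have tX := trivial_partition jX.
apply/andP; split.
  by have := lower_integral_ge jX M0 gM tX; rewrite /lower_sum big_ord1.
by have := upper_integral_le jX M0 gM tX; rewrite /upper_sum big_ord1 /integral lu.
Qed.

(** Lets a supremum be bounded after weighting by a content that may vanish. For [c = 0] the
    hypothesis puts no bound on [h], so the supremum may be a default value; the factor 0 absorbs
    it. *)
Lemma sup_image_mul_le (h : V -> R) (A : set V) c d : A !=set0 -> 0 <= c ->
  (forall x, A x -> h x * c <= d) -> sup (h @` A) * c <= d.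
Proof.
move=> [x Ax] c_ge0 hd; have [c0|c0|c0] := ltgtP 0 c; first last.
- by rewrite -c0 mulr0; have := hd x Ax; rewrite -c0 mulr0.
- by rewrite ltNge c_ge0 in c0.
rewrite -ler_pdivlMr//; apply: ge_sup; first by exists (h x), x.
by move=> _ [y Ay <-]; rewrite ler_pdivlMr//; exact: hd.
Qed.

End Integral.

(** * Darboux sums under the map G *)

Section ChangeOfVariables.
Context {R : realType} {m : nat}.
Local Notation V := 'rV[R]_m.
Variables (X : set V) (G : V -> V) (g : V -> R).
Hypothesis g_integrable : forall H, jordan_measurable H -> H `<=` X ->
  integrable H g.
Hypothesis G_jordan : forall H,
  jordan_measurable H -> H `<=` X -> jordan_measurable (G @` H).
Hypothesis G_content : forall H,
  jordan_measurable H -> H `<=` X -> content (G @` H) = integral H g.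

Lemma sup_pullback_dist (f : V -> R) M (A : set V) :
  jordan_measurable A -> A `<=` X -> 0 <= M ->
  (forall y, (G @` X) y -> `|f y| <= M) ->
  `|sup ((fun x => f (G x) * g x) @` A) * content A -
    sup (f @` (G @` A)) * content (G @` A)| <=
  M * ((sup (g @` A) - inf (g @` A)) * content A).
Proof.
move=> jA AX M0 fM; have [->|/set0P An] := eqVneq A set0.
  by rewrite !image_set0 content_set0 !mulr0 subrr normr0.
have gA := g_integrable jA AX; have [_ /bounded_funP[K _ gK] _] := gA.
have /andP[] := integral_bounds gA; rewrite -G_content//.
set v := content A; set w := content (G @` A).
set S := sup (g @` A); set I := inf (g @` A) => Iw wS.
have v0 : 0 <= v by exact: content_ge0 jA.1.
have w0 : 0 <= w by exact: content_ge0 (G_jordan jA AX).1.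
have gAK x : A x -> - K <= g x <= K by move=> /gK; rewrite ler_norml.
(* Both [g x * v] and [w] lie between [I * v] and [S * v], the latter because it is the integral of
   [g] over [A]. *)
have key x : A x -> `|f (G x) * g x * v - f (G x) * w| <= M * ((S - I) * v).
  move=> Ax; rewrite -mulrA -mulrBr normrM; apply: ler_pM => //.
    by apply: fM; exists x => //; exact: AX.
  have gS : g x <= S by apply: ub_le_sup; [exists K => _ [y /gAK/andP[_ ?] <-]|exists x].
  have Ig : I <= g x by apply: ge_inf; [exists (- K) => _ [y /gAK/andP[? _] <-]|exists x].
  have := ler_wpM2r v0 gS; have := ler_wpM2r v0 Ig.
  by rewrite ler_norml mulrBl => h1 h2; apply/andP; split; lra.
have fMA x : A x -> - M <= f (G x) <= M.
  by move=> /AX Xx; rewrite -ler_norml; apply: fM; exists x.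
(* The pointwise estimate passes to the suprema in both directions because the weights [v] and [w]
   are nonnegative. *)
rewrite ler_distl; apply/andP; split.
  rewrite lerBlDr image_comp; apply: sup_image_mul_le => // x Ax /=.
  have := key x Ax; rewrite ler_distl => /andP[h _]; rewrite lerBlDr in h.
  apply: le_trans h _; rewrite lerD2r; apply: ler_wpM2r => //.
  apply: ub_le_sup; last by exists x.
  exists (M * K) => _ [y Ay <-]; apply: le_trans (ler_norm _) _.
  rewrite normrM; apply: ler_pM => //; last by rewrite ler_norml gAK.
  by rewrite ler_norml fMA.
apply: sup_image_mul_le => // x Ax.
have := key x Ax; rewrite ler_distl => /andP[_ h].
apply: le_trans h _; rewrite lerD2r; apply: ler_wpM2r => //.
apply: ub_le_sup; last by exists (G x) => //; exists x.
by exists M => _ [_ [y /fMA/andP[_ ?] <-] <-].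
Qed.

Lemma upper_sum_pullback_dist (f : V -> R) M n (P : 'I_n -> set V) :
  jordan_partition X P -> 0 <= M -> (forall y, (G @` X) y -> `|f y| <= M) ->
  `|upper_sum (fun x => f (G x) * g x) P - upper_sum f (fun k => G @` P k)| <=
  M * (upper_sum g P - lower_sum g P).
Proof.
move=> [jP _ XP] M0 fM; rewrite /upper_sum /lower_sum -!sumrB mulr_sumr.
apply: le_trans (ler_norm_sum _ _ _) _; apply: ler_sum => k _.
rewrite -mulrBl; apply: sup_pullback_dist => //.
by rewrite -XP; exact: bigcup_sup.
Qed.

(** The upper estimate for [- f]: the sign factors out of the product, while [g] and the gap between
    its sums stay the same. *)
Lemma lower_sum_pullback_dist (f : V -> R) M n (P : 'I_n -> set V) :
  jordan_partition X P -> 0 <= M -> (forall y, (G @` X) y -> `|f y| <= M) ->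
  `|lower_sum (fun x => f (G x) * g x) P - lower_sum f (fun k => G @` P k)| <=
  M * (upper_sum g P - lower_sum g P).
Proof.
move=> PX M0 fM; have NfM y : (G @` X) y -> `|- f y| <= M by rewrite normrN; exact: fM.
rewrite [in leLHS]lower_sumN [X in - X](_ : _ = upper_sum (fun x => - f (G x) * g x) P).
  by rewrite [X in _ - X]lower_sumN -opprD normrN; exact: upper_sum_pullback_dist.
by congr (upper_sum _ P); apply/funext => x; rewrite mulNr.
Qed.

End ChangeOfVariables.

Theorem theorem7 (R : realType) (m : nat) (X : set 'rV[R]_m)
    (G : 'rV[R]_m -> 'rV[R]_m) (f g : 'rV[R]_m -> R)
    (X_jordan : jordan_measurable X)
    (G_lipschitz : [lipschitz G x | x in X])
    (f_bounded : [bounded f y | y in G @` X])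
    (g_integrable : integrable X g)
    (G_jordan : forall H : set 'rV[R]_m,
      jordan_measurable H -> H `<=` X -> jordan_measurable (G @` H))
    (G_nonoverlapping : forall A B : set 'rV[R]_m,
      jordan_measurable A -> A `<=` X -> jordan_measurable B -> B `<=` X ->
      nonoverlapping A B -> nonoverlapping (G @` A) (G @` B))
    (g_density : density_function X
      [set H | jordan_measurable H /\ H `<=` X]
      (fun H => content (G @` H)) g)
    (fg_integrable : integrable (G @` X) f \/
      integrable X (fun x => f (G x) * g x)) :
  [/\ integrable (G @` X) f,
      integrable X (fun x => f (G x) * g x) &
      integral X (fun x => f (G x) * g x) = integral (G @` X) f].

Proof.
have G_content H : jordan_measurable H -> H `<=` X ->
    content (G @` H) = integral H g.
  by move=> jH HX; have [_ _ /(_ H (conj jH HX))[]] := g_density.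
have g_int H : jordan_measurable H -> H `<=` X -> integrable H g.
  by move=> jH HX; have [_ _ /(_ H (conj jH HX))[]] := g_density.
have [M M0 fM] := (bounded_funP (G @` X) f).1 f_bounded.
have [_ /bounded_funP[K K0 gK] _] := g_integrable.
have Y_jordan : jordan_measurable (G @` X) by exact: G_jordan.
have fGg_bounded : [bounded f (G x) * g x | x in X].
  apply/bounded_funP; exists (M * K); first exact: mulr_ge0.
  by move=> x Xx; rewrite normrM ler_pM ?gK// fM//; exists x.
have [L L0 GL] : exists2 L : R, 0 < L &
    forall x y, X x -> X y -> `|G x - G y| <= L * `|x - y|.
  have [N [_ hN]] := G_lipschitz; exists (`|N| + 1); first by rewrite ltr_wpDl.
  move=> x y Xx Xy; apply: (hN _ _ (x, y)) => //.
  by rewrite ltr_pwDr// ler_norm.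
have image_partition n (P : 'I_n -> set _) : jordan_partition X P ->
    jordan_partition (G @` X) (fun k => G @` P k).
  move=> [jP nP XP]; have PX k : P k `<=` X by rewrite -XP; exact: bigcup_sup.
  split=> [k|k l kl|]; first exact: G_jordan.
    by apply: G_nonoverlapping => //; exact: nP.
  by rewrite -XP image_bigcup.
have image_fine n (P : 'I_n -> set _) d : jordan_partition X P ->
    fine_below P (d / L) -> fine_below (fun k => G @` P k) d.
  move=> [_ _ XP] Pd k _ _ [x Px <-] [y Py <-].
  have PX z : P k z -> X z by move=> Pz; rewrite -XP; exists k.
  apply: le_lt_trans (GL _ _ (PX _ Px) (PX _ Py)) _.
  by rewrite mulrC -ltr_pdivlMr//; exact: Pd Px Py.
have pullback e : 0 < e -> exists2 d, 0 < d & forall n (P : 'I_n -> set _),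
    jordan_partition X P -> fine_below P d ->
    `|upper_sum (fun x => f (G x) * g x) P - upper_sum f (fun k => G @` P k)| <= e /\
    `|lower_sum (fun x => f (G x) * g x) P - lower_sum f (fun k => G @` P k)| <= e.
  move=> e0; have M1 : 0 < 2 * M + 1 by lra.
  (* Both Darboux sums of [g] will lie within this distance of its integral, so [M] times their gap
     is at most [2 * M] times it, hence at most [e]. *)
  have e10 : 0 < e / (2 * M + 1) by rewrite divr_gt0.
  have [d d0 hd] := integrable_fine_sums g_integrable e10.
  exists d => // n P PX Pd; have [h1 h2] := hd n P PX Pd.
  have oscM : M * (upper_sum g P - lower_sum g P) <= e.
    apply: (@le_trans _ _ (M * (2 * (e / (2 * M + 1))))).
      by apply: ler_wpM2l => //; lra.
    by rewrite mulrCA mulrA mulrA ler_pdivrMr// mulrC ler_pM2l//; lra.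
  split; apply: le_trans oscM.
    exact: (upper_sum_pullback_dist g_int G_jordan G_content PX M0 fM).
  exact: (lower_sum_pullback_dist g_int G_jordan G_content PX M0 fM).
case: fg_integrable => [f_int|fGg_int].
- have [] := @integrable_of_sums _ _ X (fun x => f (G x) * g x)
    (integral (G @` X) f) X_jordan fGg_bounded; last by [].
  (* One half of [e] pays for the passage between the two functions, the other for the sums of [f]
     over the image partition. *)
  move=> e e0; have e20 : 0 < e / 2 by rewrite divr_gt0.
  have [d d0 hd] := pullback _ e20.
  have [d' d0' hd'] := integrable_fine_sums f_int e20.
  have dd : 0 < Order.min d (d' / L) by rewrite lt_min d0 divr_gt0.
  have [n [P [PX Pdd]]] := fine_partition X_jordan dd.
  have Pd : fine_below P d by apply: fine_belowS Pdd; rewrite ge_min lexx.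
  have Pd' : fine_below P (d' / L) by apply: fine_belowS Pdd; rewrite ge_min lexx orbT.
  have [] := hd n P PX Pd; rewrite !ler_distl => /andP[? ?] /andP[? ?].
  have [? ?] := hd' n _ (image_partition n P PX) (image_fine n P d' PX Pd').
  by exists n, P; split=> //; lra.
- have [] := @integrable_of_sums _ _ (G @` X) f
    (integral X (fun x => f (G x) * g x)) Y_jordan f_bounded; last by [].
  move=> e e0; have e20 : 0 < e / 2 by rewrite divr_gt0.
  have [d d0 hd] := pullback _ e20.
  have [d' d0' hd'] := integrable_fine_sums fGg_int e20.
  have dd : 0 < Order.min d d' by rewrite lt_min d0.
  have [n [P [PX Pdd]]] := fine_partition X_jordan dd.
  have Pd : fine_below P d by apply: fine_belowS Pdd; rewrite ge_min lexx.
  have Pd' : fine_below P d' by apply: fine_belowS Pdd; rewrite ge_min lexx orbT.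
  have [] := hd n P PX Pd; rewrite !ler_distl => /andP[? ?] /andP[? ?].
  have [? ?] := hd' n P PX Pd'.
  (* The criterion asks for one partition of the image per [e], and the image of a fine partition of
     [X] supplies it. *)
  exists n, (fun k => G @` P k); split; [exact: image_partition|lra|lra].
Qed.
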